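(* Let $\mu$ be a unital linear functional on $\mathbb{C}[x]$, with moments $m_n=\mu(x^n)$, Boolean cumulants $\kappa_n$, and Boolean cumulant generating function $\eta(z)=\sum_{n\ge 1}\kappa_n z^n$. The Boolean Appell polynomials $\{A_n\}_{n\ge 0}$ corresponding to $\mu$ have the following properties. (a) (centering) $A_0(x)=1$ and $\mu(A_n)=0$ for $n>0$. (b) (differential recursion) $D A_n=A_{n-1}$ for $n\ge 1$, where $Df(x)=\frac{f(x)-f(0)}{x}$. (c) (recursion) $xA_n=A_{n+1}+\kappa_{n+1}$ for $n\ge 0$. (d) (explicit formula) $A_n(x)=x^n-\sum_{k=1}^n\kappa_k x^{n-k}$. (e) (generating function) $$\sum_{n=0}^\infty A_n(x)z^n=\frac{1-\eta(z)}{1-xz}=\frac{\frac1z-K\left(\frac1z\right)}{\frac1z-x}.$$ (f) (powers-of-$x$ expansion) $x^n=\sum_{k=0}^n m_kA_{n-k}(x)$.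
   Context: A linear functional $\mu$ on $\mathbb{C}[x]$ is unital if $\mu(1)=1$. The Boolean Appell polynomials corresponding to $\mu$ are the polynomials $A_n$ determined by $A_0=1$, $DA_n=A_{n-1}$ for $n\ge1$ with $Df(x)=\frac{f(x)-f(0)}{x}$, and $\mu(A_n)=\delta_{n,0}$. With $M(z)=\sum_{n\ge1}m_nz^n$, the Boolean cumulant generating function is $\eta(z)=1-(1+M(z))^{-1}=\sum_{n\ge1}\kappa_nz^n$ (a formal power series); its coefficients $\kappa_n$ are the Boolean cumulants of $\mu$. $K$ is defined by $\eta(z)=zK(1/z)$, i.e. $K(1/z)=\eta(z)/z$ (when $\mu$ is a positive measure on $\mathbb{R}$ with all moments finite, $K(z)=z-1/G_\mu(z)$ with $G_\mu(z)=\int\frac{1}{z-x}\,d\mu(x)$). Identities are between formal power series in $z$. *)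

(* Defs.v *)
(* Complex numbers are R[i] over an R : realType.                             *)
From HB Require Import structures.
From mathcomp Require Export all_boot all_order all_algebra.
From mathcomp Require Export complex.
From mathcomp Require Export boolp reals.

Set Implicit Arguments.
Unset Strict Implicit.
Unset Printing Implicit Defensive.

Import GRing.Theory.
Local Open Scope ring_scope.

(* Formal power series in one variable z, given by their coefficients. A      *)
(* record rather than a bare function nat -> R, so that the product is not    *)
(* confused with the pointwise one.                                           *)
Record fps (R : Type) := Fps { fps_coef : nat -> R }.

Notation "f `_z n" := (fps_coef f n)
  (at level 3, n at level 2, left associativity, format "f `_z  n") : ring_scope.

HB.instance Definition _ (R : Type) := gen_eqMixin (fps R).
HB.instance Definition _ (R : Type) := gen_choiceMixin (fps R).

Lemma fpsP (R : Type) (f g : fps R) :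
  (forall n, fps_coef f n = fps_coef g n) <-> f = g.
Proof.
by split=> [|->//]; case: f g => f [g] /= fg; congr Fps; apply: funext.
Qed.

Section FpsZmodule.
Variable R : zmodType.
Implicit Types f g h : fps R.

Definition fps_zero : fps R := Fps (fun=> 0).
Definition fps_opp f : fps R := Fps (fun n => - f`_z n).
Definition fps_add f g : fps R := Fps (fun n => f`_z n + g`_z n).

Fact fps_addA : associative fps_add.
Proof. by move=> f g h; apply/fpsP => n /=; rewrite addrA. Qed.
Fact fps_addC : commutative fps_add.
Proof. by move=> f g; apply/fpsP => n /=; rewrite addrC. Qed.
Fact fps_add0 : left_id fps_zero fps_add.
Proof. by move=> f; apply/fpsP => n /=; rewrite add0r. Qed.
Fact fps_addN : left_inverse fps_zero fps_opp fps_add.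
Proof. by move=> f; apply/fpsP => n /=; rewrite addNr. Qed.

HB.instance Definition _ :=
  GRing.isZmodule.Build (fps R) fps_addA fps_addC fps_add0 fps_addN.

Lemma fps_coef0 n : (0 : fps R)`_z n = 0. Proof. by []. Qed.
Lemma fps_coefD f g n : (f + g)`_z n = f`_z n + g`_z n. Proof. by []. Qed.
Lemma fps_coefN f n : (- f)`_z n = - f`_z n. Proof. by []. Qed.
Lemma fps_coefB f g n : (f - g)`_z n = f`_z n - g`_z n. Proof. by []. Qed.

End FpsZmodule.

Section FpsRing.
Variable R : comNzRingType.
Implicit Types f g h : fps R.

Definition fpsC (c : R) : fps R := Fps (fun n => if n == 0%N then c else 0).
Definition fpsX : fps R := Fps (fun n => (n == 1%N)%:R).
Definition fps_mul f g : fps R :=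
  Fps (fun n => \sum_(i < n.+1) f`_z i * g`_z (n - i)).

Let trunc N f : {poly R} := \poly_(i < N.+1) f`_z i.

Let coef_trunc N f n : (n <= N)%N -> (trunc N f)`_n = f`_z n.
Proof. by move=> nN; rewrite coef_poly ltnS nN. Qed.

Let fps_mul_poly f g (p q : {poly R}) n :
  (forall k, (k <= n)%N -> p`_k = f`_z k) ->
  (forall k, (k <= n)%N -> q`_k = g`_z k) ->
  forall k, (k <= n)%N -> (p * q)`_k = (fps_mul f g)`_z k.
Proof.
move=> pf qg k kn; rewrite coefM /=; apply: eq_bigr => i _.
rewrite pf ?qg //; first by rewrite (leq_trans (leq_subr _ _)).
by rewrite (leq_trans _ kn) // -ltnS.
Qed.

Fact fps_mulA : associative fps_mul.
Proof.
move=> f g h; apply/fpsP => n.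
have T u k : (k <= n)%N -> (trunc n u)`_k = u`_z k by exact: coef_trunc.
rewrite -(fps_mul_poly (T f) (fps_mul_poly (T g) (T h)) (leqnn n)).
by rewrite -(fps_mul_poly (fps_mul_poly (T f) (T g)) (T h) (leqnn n)) mulrA.
Qed.

Fact fps_mulC : commutative fps_mul.
Proof.
move=> f g; apply/fpsP => n.
have T u k : (k <= n)%N -> (trunc n u)`_k = u`_z k by exact: coef_trunc.
rewrite -(fps_mul_poly (T f) (T g) (leqnn n)) mulrC.
by rewrite -(fps_mul_poly (T g) (T f) (leqnn n)).
Qed.

Fact fps_mul1 : left_id (fpsC 1) fps_mul.
Proof.
move=> f; apply/fpsP => n /=; rewrite big_ord_recl /= mul1r subn0.
by rewrite big1 ?addr0 // => i _; rewrite mul0r.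
Qed.

Fact fps_mulDl : left_distributive fps_mul +%R.
Proof.
move=> f g h; apply/fpsP => n /=; rewrite -big_split /=.
by apply: eq_bigr => i _; rewrite mulrDl.
Qed.

Fact fps_one_neq0 : fpsC 1 != 0.
Proof.
by apply/eqP => /fpsP/(_ 0%N)/= /eqP; rewrite oner_eq0.
Qed.

HB.instance Definition _ := GRing.Zmodule_isComNzRing.Build (fps R)
  fps_mulA fps_mulC fps_mul1 fps_mulDl fps_one_neq0.

Lemma fps_coefM f g n : (f * g)`_z n = \sum_(i < n.+1) f`_z i * g`_z (n - i).
Proof. by []. Qed.

Lemma fps_coef1 n : (1 : fps R)`_z n = (n == 0%N)%:R.
Proof. by rewrite /=; case: eqP. Qed.

End FpsRing.

Arguments fpsX {R}.

Section FpsUnitRing.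
Variable R : comUnitRingType.
Implicit Types f g : fps R.

(* The list of the coefficients of 1 / f of index at most n.                  *)
Fixpoint fps_inv_seq f (n : nat) : seq R :=
  if n is m.+1 then
    let s := fps_inv_seq f m in
    rcons s (- (f`_z 0)^-1 * \sum_(i < m.+1) f`_z (m.+1 - i) * s`_i)
  else [:: (f`_z 0)^-1].

Definition fps_unit : {pred fps R} := fun f => f`_z 0 \is a GRing.unit.

Definition fps_inv f : fps R :=
  if fps_unit f then Fps (fun n => (fps_inv_seq f n)`_n) else f.

Let size_inv_seq f n : size (fps_inv_seq f n) = n.+1.
Proof. by elim: n => //= n IHn; rewrite size_rcons IHn. Qed.

Let nth_inv_seq f n i :
  (i <= n)%N -> (fps_inv_seq f n)`_i = (fps_inv_seq f i)`_i.
Proof.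
elim: n => [|n IHn]; first by rewrite leqn0 => /eqP->.
rewrite leq_eqVlt => /orP[/eqP-> //|lt_in].
by rewrite [fps_inv_seq f n.+1]/= nth_rcons size_inv_seq lt_in IHn.
Qed.

Fact fps_mulVx : {in fps_unit, left_inverse 1 fps_inv *%R}.
Proof.
move=> f Uf; have Uf0 : f`_z 0 \is a GRing.unit by exact: Uf.
rewrite mulrC /fps_inv (_ : fps_unit f = true) //.
apply/fpsP => n; rewrite fps_coefM fps_coef1 (reindex_inj rev_ord_inj) /=.
case: n => [|n]; first by rewrite big_ord1 /= divrr.
rewrite big_ord_recr /= subnn subn0 nth_rcons size_inv_seq ltnn eqxx.
rewrite mulNr mulrN mulVKr //; apply/eqP; rewrite subr_eq0; apply/eqP.
apply: eq_bigr => i _; have le_in : (i <= n)%N by rewrite -ltnS.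
by rewrite !subSS subKn ?leqW // -(nth_inv_seq f le_in).
Qed.

Fact fps_unitPl f g : g * f = 1 -> fps_unit f.
Proof.
move=> /fpsP/(_ 0%N); rewrite fps_coefM fps_coef1 big_ord1 /= => gf1.
by rewrite /fps_unit; apply/unitrPr; exists (g`_z 0); rewrite mulrC.
Qed.

Fact fps_inv_out : {in [predC fps_unit], fps_inv =1 id}.
Proof. by move=> f /negPf Nf; rewrite /fps_inv (_ : fps_unit f = false). Qed.

HB.instance Definition _ := GRing.ComNzRing_hasMulInverse.Build (fps R)
  fps_mulVx fps_unitPl fps_inv_out.

Lemma fps_unitE f : (f \is a GRing.unit) = (f`_z 0 \is a GRing.unit).
Proof. by []. Qed.

End FpsUnitRing.

Section FpsIdomain.
Variable R : idomainType.

Fact fps_mulf_eq0 (f g : fps R) : f * g = 0 -> (f == 0) || (g == 0).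
Proof.
have ex_low (h : fps R) : h != 0 ->
    exists2 i, h`_z i != 0 & forall k, (k < i)%N -> h`_z k = 0.
  move=> h0; have hP : exists n, h`_z n != 0.
    apply/not_existsP => hz; case/eqP: h0; apply/fpsP => n.
    by apply/eqP; apply: contra_notT (hz n).
  case: (ex_minnP hP) => i hi mini; exists i => // k ki.
  by apply/eqP; apply: contraTT ki => /mini; rewrite -leqNgt.
move=> fg0; apply/norP => -[/ex_low[i fi ltf] /ex_low[j gj ltg]].
move/fpsP/(_ (i + j)%N): fg0; rewrite fps_coefM fps_coef0.
have lt_i : (i < (i + j).+1)%N by rewrite ltnS leq_addr.
rewrite (bigD1 (Ordinal lt_i)) //= big1 => [/eqP|k ki].
  by rewrite addr0 addKn mulf_eq0 (negPf fi) (negPf gj).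
have {ki} : (k : nat) != i by apply: contraNneq ki => ki; apply/eqP/val_inj.
rewrite neq_ltn => /orP[/ltf->|ik]; first by rewrite mul0r.
rewrite (ltg (i + j - k)%N) ?mulr0 //.
have le_k : (k <= i + j)%N by rewrite -ltnS ltn_ord.
by rewrite ltn_subLR // ltn_add2r.
Qed.

HB.instance Definition _ :=
  GRing.ComUnitRing_isIntegral.Build (fps R) fps_mulf_eq0.

End FpsIdomain.

Definition fps_map (R S : Type) (phi : R -> S) (f : fps R) : fps S :=
  Fps (fun n => phi f`_z n).

(* The division by 'X is exact, see DdiffK.                                   *)
Definition Ddiff (F : fieldType) (f : {poly F}) : {poly F} :=
  (f - f.[0]%:P) %/ 'X.

Section Appell.
Variables (F : fieldType) (mu : {scalar {poly F}}).

Definition unital : Prop := mu 1 = 1.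

Definition moment (n : nat) : F := mu 'X^n.

Definition moment_gf : fps F := Fps (fun n => if n == 0%N then 0 else moment n).

Definition boolean_gf : fps F := 1 - (1 + moment_gf)^-1.

Definition boolean_cumulant (n : nat) : F := boolean_gf`_z n.

Definition is_boolean_appell (A : nat -> {poly F}) : Prop :=
  [/\ A 0%N = 1,
      forall n, (1 <= n)%N -> Ddiff (A n) = A n.-1
    & forall n, mu (A n) = (n == 0%N)%:R].

(* The series \sum_n A_n(x) z^n, with coefficients in F[x]; likewise eta below.*)
Definition appell_gf (A : nat -> {poly F}) : fps {poly F} := Fps A.

Definition boolean_gfx : fps {poly F} := fps_map polyC boolean_gf.

Definition xvar : fps {poly F} := fpsC 'X.

(* K(1/z) = eta(z) / z. Since the formula also involves 1/z, which is not a   *)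
(* power series, it is read in the fraction field of F[x][[z]], which         *)
(* contains the Laurent series F[x]((z)).                                     *)
Definition K_at_inv_z : {fraction fps {poly F}} :=
  tofrac boolean_gfx / tofrac fpsX.

(* The inverses taken in boolean_gf and in (1 - eta) / (1 - x * z) are true   *)
(* inverses, as their constant coefficients are units.                        *)

Lemma moment_gf_unit : 1 + moment_gf \is a GRing.unit.
Proof. by rewrite fps_unitE fps_coefD /= addr0 unitr1. Qed.

Lemma boolean_cumulant0 : boolean_cumulant 0 = 0.
Proof.
rewrite /boolean_cumulant fps_coefB fps_coef1 /=.
have /fpsP/(_ 0%N) := mulVr moment_gf_unit.
by rewrite fps_coefM big_ord1 fps_coefD /= addr0 mulr1 => ->; rewrite subrr.
Qed.

Lemma geometric_unit : 1 - xvar * fpsX \is a GRing.unit.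
Proof.
by rewrite fps_unitE fps_coefB fps_coefM fps_coef1 big_ord1 /= mulr0 subr0 unitr1.
Qed.

Lemma fpsX_neq0 (R : comNzRingType) : (fpsX : fps R) != 0.
Proof. by apply/eqP => /fpsP/(_ 1%N) /eqP; rewrite /= oner_eq0. Qed.

Lemma DdiffK (f : {poly F}) : 'X * Ddiff f + f.[0]%:P = f.
Proof.
rewrite /Ddiff mulrC divpK ?subrK //.
by rewrite -['X]subr0 -polyC0 dvdp_XsubCl rootE !hornerE subrr.
Qed.

Lemma boolean_appell_exists_unique : unital ->
  exists2 A, is_boolean_appell A &
    forall B, is_boolean_appell B -> forall n, B n = A n.
Proof.
move=> mu1; have muC c : mu c%:P = c.
  by rewrite -[c%:P]mulr1 mul_polyC linearZ /= mu1 mulr1.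
pose A := fix A n : {poly F} :=
  if n is m.+1 then 'X * A m - (mu ('X * A m))%:P else 1.
have muA n : mu (A n.+1) = 0 by rewrite /= linearB /= muC subrr.
exists A.
  split=> // [[|n]|[|n]] // _.
  have An0 : (A n.+1).[0] = - mu ('X * A n).
    by rewrite /= hornerD hornerN hornerC hornerM hornerX mul0r sub0r.
  by rewrite /Ddiff An0 /= polyCN opprK subrK mulKp ?polyX_eq0.
move=> B [B0 DB muB]; elim=> // n IHn.
have := DdiffK (B n.+1); rewrite DB // [n.+1.-1]/= IHn => def_B.
have : mu (B n.+1) = 0 by rewrite muB.
rewrite -def_B linearD /= muC => /eqP; rewrite addrC addr_eq0 => /eqP->.
by rewrite polyCN.
Qed.

End Appell.

(* Main.v *)
Require Import Defs.
From mathcomp Require Import all_boot all_order all_algebra.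
From mathcomp Require Import complex boolp reals.
Import GRing.Theory.
Local Open Scope ring_scope.

(** Let C(z) be the series of the constant terms A_n(0). Since D removes the
    constant term and divides by x, the equations D A_n = A_(n-1) and A_0 = 1
    say together that (1 - x z) G(z) = C(z), where G(z) is the generating
    function of the A_n ([appell_gfM_geometric]). As 1 / (1 - x z) is the series
    of the powers of x, this makes A_n the convolution of C with those powers
    ([appell_convol]); applying mu turns the powers of x into moments, so that
    the conditions mu(A_n) = 0 for n > 0 and mu(A_0) = 1 become
    C(z) (1 + M(z)) = 1. Hence C = 1 - eta ([appell_const_gf]): the Boolean
    cumulants are the numbers - A_n(0).

    Everything else is read off from this identity. The generating function
    is (1 - eta) / (1 - x z), and its form with K comes from multiplying
    numerator and denominator by 1 / z. The recursion x A_n = A_(n+1) +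
    kappa_(n+1) and the explicit formula for A_n are the coefficients of
    (1 - x z) G = 1 - eta and of G = (1 - eta) (1 / (1 - x z)). Finally,
    multiplying G by 1 + M cancels 1 - eta and leaves 1 / (1 - x z), whose
    coefficients expand the powers of x in the A_n. *)

Section FormalSeries.
Variable R : comNzRingType.
Implicit Types f g : fps R.

Lemma fps_coefCM (c : R) f n : (fpsC c * f)`_z n = c * f`_z n.
Proof.
rewrite fps_coefM big_ord_recl /= subn0 big1 ?addr0 // => i _.
by rewrite mul0r.
Qed.

Lemma fps_coefXM f n : (fpsX * f)`_z n = if n is m.+1 then f`_z m else 0.
Proof.
case: n => [|n]; first by rewrite fps_coefM big_ord1 /= mul0r.
rewrite fps_coefM !big_ord_recl /= mul0r add0r mul1r subSS subn0.
by rewrite big1 ?addr0 // => i _; rewrite mul0r.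
Qed.

Lemma fps_map_polyCM f g :
  fps_map polyC (f * g) = fps_map polyC f * fps_map polyC g.
Proof.
apply/fpsP => n; rewrite /= rmorph_sum /=.
by apply: eq_bigr => i _; rewrite polyCM.
Qed.

Lemma fps_map_polyC1 : fps_map polyC (1 : fps R) = 1.
Proof. by apply/fpsP => -[|n]; rewrite /= ?polyC1 ?polyC0. Qed.

End FormalSeries.

Section BooleanAppell.
Variables (F : fieldType) (mu : {scalar {poly F}}).

Definition powers_gf : fps {poly F} := Fps (fun n => 'X^n).

Lemma coef_geometricM (g : fps {poly F}) n :
  ((1 - xvar F * fpsX) * g)`_z n =
    g`_z n - (if n is m.+1 then 'X * g`_z m else 0).
Proof.
rewrite mulrBl mul1r -mulrA fps_coefB fps_coefCM fps_coefXM.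
by case: n => //; rewrite mulr0.
Qed.

Lemma powers_gfE : powers_gf = (1 - xvar F * fpsX)^-1.
Proof.
apply: (mulrI (geometric_unit F)); rewrite divrr ?geometric_unit //.
apply/fpsP => n; rewrite coef_geometricM fps_coef1.
by case: n => [|n] /=; rewrite ?expr0 ?subr0 // exprS subrr.
Qed.

(** Unitality is what makes the constant term 1 of 1 + M equal to m_0. *)
Lemma coef_moments n : unital mu -> (1 + moment_gf mu)`_z n = moment mu n.
Proof.
move=> mu1; rewrite fps_coefD fps_coef1.
by case: n => [|n] /=; rewrite ?add0r // addr0 /moment expr0 mu1.
Qed.

Lemma one_sub_boolean_gfx :
  1 - boolean_gfx mu = fps_map polyC (1 + moment_gf mu)^-1.
Proof.
have -> : (1 + moment_gf mu)^-1 = 1 - boolean_gf mu by rewrite subKr.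
apply/fpsP => n; rewrite -[RHS]/(((1 - boolean_gf mu)`_z n)%:P).
by rewrite fps_coefB [in RHS]fps_coefB !fps_coef1 polyCB polyC_natr.
Qed.

Section AppellSequence.
Variable A : nat -> {poly F}.
Hypotheses (mu1 : unital mu) (appellA : is_boolean_appell mu A).

Let const_gf : fps F := Fps (fun n => (A n).[0]).

Lemma appell_gfM_geometric :
  (1 - xvar F * fpsX) * appell_gf A = fps_map polyC const_gf.
Proof.
have [A0 DA _] := appellA; apply/fpsP => n.
rewrite coef_geometricM; case: n => [|n] /=; first by rewrite A0 subr0 hornerC.
by rewrite -{1}(DdiffK (A n.+1)) DA //= addrC addKr.
Qed.

Lemma appell_convol n : A n = \sum_(i < n.+1) (A i).[0] *: 'X^(n - i).
Proof.
have /fpsP/(_ n)/= : appell_gf A = fps_map polyC const_gf * powers_gf.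
  by rewrite -appell_gfM_geometric powers_gfE mulrC mulKr ?geometric_unit.
by move=> ->; apply: eq_bigr => i _; rewrite mul_polyC.
Qed.

(** Applying mu to the convolution formula turns the normalization of the A_n
    into the statement that their constant terms invert the moment series. *)
Lemma appell_const_gf : const_gf = (1 + moment_gf mu)^-1.
Proof.
have [_ _ muA] := appellA.
apply: (mulIr (moment_gf_unit mu)); rewrite mulVr ?moment_gf_unit //.
apply/fpsP => n; rewrite fps_coef1 -muA appell_convol linear_sum fps_coefM.
by apply: eq_bigr => i _; rewrite coef_moments // linearZ.
Qed.

Lemma appell_const n : (A n.+1).[0] = - boolean_cumulant mu n.+1.
Proof.
have /fpsP/(_ n.+1)/= -> := appell_const_gf.
by rewrite /boolean_cumulant fps_coefB fps_coef1 sub0r opprK.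
Qed.

Lemma appell_recursion n :
  'X * A n = A n.+1 + (boolean_cumulant mu n.+1)%:P.
Proof.
have [_ DA _] := appellA.
by rewrite -{1}(DdiffK (A n.+1)) DA //= appell_const polyCN subrK.
Qed.

Lemma appell_explicit n :
  A n = 'X^n - \sum_(1 <= k < n.+1) boolean_cumulant mu k *: 'X^(n - k).
Proof.
have [A0 _ _] := appellA.
rewrite {1}appell_convol big_ord_recl /= A0 hornerC scale1r subn0.
rewrite big_add1 big_mkord -sumrN; congr (_ + _); apply: eq_bigr => i _.
by rewrite appell_const scaleNr.
Qed.

Lemma appell_gfE :
  appell_gf A = (1 - boolean_gfx mu) / (1 - xvar F * fpsX).
Proof.
rewrite one_sub_boolean_gfx -appell_const_gf -appell_gfM_geometric.
by rewrite mulrC mulKr ?geometric_unit.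
Qed.

Lemma powers_appell n :
  'X^n = \sum_(0 <= k < n.+1) moment mu k *: A (n - k)%N.
Proof.
have /fpsP/(_ n) :
    powers_gf = fps_map polyC (1 + moment_gf mu) * appell_gf A.
  rewrite appell_gfE one_sub_boolean_gfx mulrA -fps_map_polyCM.
  by rewrite divrr ?moment_gf_unit // fps_map_polyC1 mul1r powers_gfE.
rewrite fps_coefM [LHS]/= => ->; rewrite big_mkord; apply: eq_bigr => i _.
by rewrite -mul_polyC -coef_moments.
Qed.

End AppellSequence.

(** The series z has no inverse among power series, but it has one in the
    fraction field, where numerator and denominator can be divided by it. *)
Lemma tofrac_appell_gf :
  let z : fps {poly F} := fpsX in
  let x := xvar F in
  tofrac ((1 - boolean_gfx mu) / (1 - x * z)) =
    ((tofrac z)^-1 - K_at_inv_z mu) / ((tofrac z)^-1 - tofrac x).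
Proof.
move=> z x; rewrite rmorphM rmorphV ?geometric_unit //= !rmorphB rmorphM rmorph1.
have z0 : tofrac z != 0 by rewrite tofrac_eq0 fpsX_neq0.
rewrite /K_at_inv_z -/z -{1}[(tofrac z)^-1]mul1r -mulrBl.
have -> : (tofrac z)^-1 - tofrac x = (1 - tofrac x * tofrac z) / tofrac z.
  by rewrite mulrBl mul1r mulfK.
by rewrite invfM invrK mulrACA mulVf // mulr1.
Qed.

End BooleanAppell.

Theorem proposition1 (R : realType) (mu : {scalar {poly R[i]}})
    (A : nat -> {poly R[i]}) :
  unital mu ->
  is_boolean_appell mu A ->
  let kappa := boolean_cumulant mu in
  let m := moment mu in
  let eta := boolean_gfx mu in
  let z : fps {poly R[i]} := fpsX in
  let x : fps {poly R[i]} := xvar R[i] in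
  (* (a) *) (A 0%N = 1 /\ forall n : nat, (0 < n)%N -> mu (A n) = 0) /\
  (* (b) *) (forall n : nat, (1 <= n)%N -> Ddiff (A n) = A n.-1) /\
  (* (c) *) (forall n : nat, 'X * A n = A n.+1 + (kappa n.+1)%:P) /\
  (* (d) *) (forall n : nat,
      A n = 'X^n - \sum_(1 <= k < n.+1) kappa k *: 'X^(n - k)) /\
  (* (e) *) (appell_gf A = (1 - eta) / (1 - x * z) /\
      tofrac ((1 - eta) / (1 - x * z)) =
        ((tofrac z)^-1 - K_at_inv_z mu) / ((tofrac z)^-1 - tofrac x)) /\
  (* (f) *) (forall n : nat, 'X^n = \sum_(0 <= k < n.+1) m k *: A (n - k)%N).
Proof.
move=> mu1 appellA kappa m eta z x; have [A0 DA muA] := appellA.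
split; first by split=> // -[|n] // _; rewrite muA.
split; first exact: DA.
split; first exact: appell_recursion.
split; first exact: appell_explicit.
split; last exact: powers_appell.
by split; [exact: appell_gfE | exact: tofrac_appell_gf].
Qed.
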